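(* Let $N\ge 2$, let $Q\in\mathbb{S}^N$ and $O=QQ^*\in\mathbb{H}^{N\times N}$. Let $\hat O\in\mathbb{H}^{N\times N}$ be a hermitian quaternion matrix all of whose entries are unitary quaternions and whose diagonal entries are equal to $1$. Let $\lambda_1\ge\lambda_2\ge\dots\ge\lambda_N$ be the (real) right eigenvalues of $\hat O$, counted with multiplicity, and let $e(O)=\|\hat O-O\|_F/\|O\|_F$. Then $$1-e(O)\le\frac{\lambda_1}{N}\le 1\qquad\text{and}\qquad \frac{|\lambda_i|}{N}\le e(O)\quad\text{for all } i\in\{2,\dots,N\}.$$ In particular, if $e(O)<1/2$, then $\lambda_1-\lambda_2>0$.
   Context: $\mathbb{H}$ denotes the quaternions and $\mathbb{S}$ the set of unitary quaternions (Euclidean norm $1$); $\mathbb{S}^N$ is the set of column vectors of length $N$ with entries in $\mathbb{S}$. $*$ is conjugate transposition; a quaternion matrix $A$ is hermitian if $A=A^*$. A hermitian quaternion matrix has only real right eigenvalues ($AV=V\lambda$, $V\neq0$) and is diagonalisable in an orthonormal basis, and multiplicities refer to this diagonalisation. The Frobenius norm is $\|A\|_F=\mathrm{Tr}(A^*A)^{1/2}$. *)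

(* Defs.v *)
From HB Require Import structures.
From mathcomp Require Import all_boot all_order all_algebra.
From mathcomp Require Import reals.
From mathcomp Require Import ring.

Set Implicit Arguments.
Unset Strict Implicit.
Unset Printing Implicit Defensive.

Import Order.TTheory GRing.Theory Num.Theory.
Local Open Scope ring_scope.

(* Quat a b c d is a + b i + c j + d k. *)
Record quaternion (R : Type) : Type :=
  Quat { qre : R; qi : R; qj : R; qk : R }.

Definition quat_code (R : Type) (q : quaternion R) : R * R * (R * R) :=
  ((qre q, qi q), (qj q, qk q)).
Definition quat_decode (R : Type) (t : R * R * (R * R)) : quaternion R :=
  Quat t.1.1 t.1.2 t.2.1 t.2.2.
Lemma quat_codeK (R : Type) : cancel (@quat_code R) (@quat_decode R).
Proof. by case. Qed.

HB.instance Definition _ (R : choiceType) :=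
  Choice.copy (quaternion R) (can_type (@quat_codeK R)).

Definition quat_zero (R : zmodType) : quaternion R := Quat 0 0 0 0.
Definition quat_add (R : zmodType) (p q : quaternion R) : quaternion R :=
  Quat (qre p + qre q) (qi p + qi q) (qj p + qj q) (qk p + qk q).
Definition quat_opp (R : zmodType) (q : quaternion R) : quaternion R :=
  Quat (- qre q) (- qi q) (- qj q) (- qk q).

Lemma quat_addA (R : zmodType) : associative (@quat_add R).
Proof. by move=> x y z; rewrite /quat_add /= !addrA. Qed.
Lemma quat_addC (R : zmodType) : commutative (@quat_add R).
Proof. by move=> x y; congr Quat; rewrite addrC. Qed.
Lemma quat_0add (R : zmodType) : left_id (quat_zero R) (@quat_add R).
Proof. by case=> a b c d; rewrite /quat_add /= !add0r. Qed.
Lemma quat_addN (R : zmodType) : left_inverse (quat_zero R) (@quat_opp R) (@quat_add R).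
Proof. by case=> a b c d; rewrite /quat_add /= !addNr. Qed.

HB.instance Definition _ (R : zmodType) :=
  GRing.isZmodule.Build (quaternion R)
    (@quat_addA R) (@quat_addC R) (@quat_0add R) (@quat_addN R).

(* Hamilton product: i^2 = j^2 = k^2 = ijk = -1. *)
Definition quat_mul (R : comNzRingType) (p q : quaternion R) : quaternion R :=
  let: Quat a1 b1 c1 d1 := p in
  let: Quat a2 b2 c2 d2 := q in
  Quat (a1 * a2 - b1 * b2 - c1 * c2 - d1 * d2)
       (a1 * b2 + b1 * a2 + c1 * d2 - d1 * c2)
       (a1 * c2 - b1 * d2 + c1 * a2 + d1 * b2)
       (a1 * d2 + b1 * c2 - c1 * b2 + d1 * a2).

Definition quat_real (R : zmodType) (x : R) : quaternion R := Quat x 0 0 0.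

Lemma quat_mulA (R : comNzRingType) : associative (@quat_mul R).
Proof. by case=> ? ? ? ? [? ? ? ?] [? ? ? ?] /=; congr Quat; ring. Qed.
Lemma quat_1mul (R : comNzRingType) : left_id (quat_real (1 : R)) (@quat_mul R).
Proof. by case=> ? ? ? ? /=; congr Quat; ring. Qed.
Lemma quat_mul1 (R : comNzRingType) : right_id (quat_real (1 : R)) (@quat_mul R).
Proof. by case=> ? ? ? ? /=; congr Quat; ring. Qed.
Lemma quat_mulDl (R : comNzRingType) : left_distributive (@quat_mul R) (@quat_add R).
Proof. by case=> ? ? ? ? [? ? ? ?] [? ? ? ?]; congr Quat => /=; ring. Qed.
Lemma quat_mulDr (R : comNzRingType) : right_distributive (@quat_mul R) (@quat_add R).
Proof. by case=> ? ? ? ? [? ? ? ?] [? ? ? ?]; congr Quat => /=; ring. Qed.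
Lemma quat_one_neq0 (R : comNzRingType) : quat_real (1 : R) != 0 :> quaternion R.
Proof. by apply/eqP => -[] /eqP; rewrite oner_eq0. Qed.

HB.instance Definition _ (R : comNzRingType) :=
  GRing.Zmodule_isNzRing.Build (quaternion R)
    (@quat_mulA R) (@quat_1mul R) (@quat_mul1 R) (@quat_mulDl R) (@quat_mulDr R) (@quat_one_neq0 R).

Definition quat_conj (R : zmodType) (q : quaternion R) : quaternion R :=
  Quat (qre q) (- qi q) (- qj q) (- qk q).

Definition quat_norm (R : realType) (q : quaternion R) : R :=
  Num.sqrt (qre q ^+ 2 + qi q ^+ 2 + qj q ^+ 2 + qk q ^+ 2).

Definition quat_unitary (R : realType) (q : quaternion R) : Prop := quat_norm q = 1.

Definition adjmx (R : zmodType) (m n : nat) (A : 'M[quaternion R]_(m, n)) :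
  'M[quaternion R]_(n, m) := (map_mx (@quat_conj R) A)^T.

Definition quat_hermitian (R : zmodType) (n : nat) (A : 'M[quaternion R]_n) : Prop :=
  A = adjmx A.

(* The quaternion \tr (adjmx A *m A) is real (frobenius_trace_real below),
   so taking its real part only changes its type. *)
Definition frobenius (R : realType) (m n : nat)
  (A : 'M[quaternion R]_(m, n)) : R := Num.sqrt (qre (\tr (adjmx A *m A))).

Lemma frobenius_trace_real (R : realType) (m n : nat)
    (A : 'M[quaternion R]_(m, n)) :
  \tr (adjmx A *m A) = quat_real (qre (\tr (adjmx A *m A))).
Proof.
rewrite /mxtrace; apply: (big_ind (fun q : quaternion R => q = quat_real (qre q))).
- by [].
- by move=> x y -> ->; congr Quat => /=; rewrite addr0.
move=> i _; rewrite mxE.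
apply: (big_ind (fun q : quaternion R => q = quat_real (qre q))).
- by [].
- by move=> x y -> ->; congr Quat => /=; rewrite addr0.
by move=> j _; rewrite !mxE; case: (A j i) => ? ? ? ?; congr Quat => /=; ring.
Qed.

(* mu%:M is 1 x 1, so v *m mu%:M is v with every entry multiplied by mu on the
   right. *)
Definition right_eigenvector (R : realType) (n : nat)
    (A : 'M[quaternion R]_n) (mu : quaternion R) (v : 'cV[quaternion R]_n) :
  Prop := v != 0 /\ A *m v = v *m mu%:M.

(* The columns of V form an orthonormal basis of right eigenvectors of A for
   the real eigenvalues lam; an eigenvalue is repeated in lam according to its
   multiplicity in this diagonalisation. *)
Definition right_spectrum (R : realType) (n : nat)
    (A : 'M[quaternion R]_n) (lam : n.-tuple R) : Prop :=
  exists V : 'M[quaternion R]_n,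
    [/\ adjmx V *m V = 1%:M,
        V *m adjmx V = 1%:M &
        forall i : 'I_n,
          right_eigenvector A (quat_real (tnth lam i)) (col i V)].

Definition relative_error (R : realType) (n : nat)
  (Ohat O : 'M[quaternion R]_n) : R := frobenius (Ohat - O) / frobenius O.

(* Main.v *)
Require Import Defs.
From HB Require Import structures.
From mathcomp Require Import all_boot all_order all_algebra.
From mathcomp Require Import reals.
From mathcomp Require Import ring lra.

(* With l_k = lambda_k / N, the unitary entries give sum l_k^2 = 1.  Expanding
   Q in the orthonormal eigenbasis and expanding ||Ohat - O||_F^2 gives
   e^2 = 2 - 2 sum p_k l_k with weights p_k >= 0 of sum 1.  Hence e <= 2 and
   l_1 >= 1 - e^2 / 2 >= 1 - e.  For k >= 2, l_k^2 <= 1 - l_1^2 <= e^2 when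
   e^2 <= 2, and l_k^2 <= 1 <= e^2 otherwise. *)

Set Implicit Arguments.
Unset Strict Implicit.
Unset Printing Implicit Defensive.

Import Order.TTheory GRing.Theory Num.Theory.
Local Open Scope ring_scope.

(** * Quaternions: real part, conjugation, squared norm *)

Lemma qre_is_zmod_morphism (R : zmodType) : zmod_morphism (@qre R).
Proof. by []. Qed.

HB.instance Definition _ (R : zmodType) :=
  GRing.isZmodMorphism.Build (quaternion R) R (@qre R)
    (@qre_is_zmod_morphism R).

Lemma quat_conj_is_zmod_morphism (R : zmodType) :
  zmod_morphism (@quat_conj R).
Proof. by move=> [? ? ? ?] [? ? ? ?]; congr Quat => /=; rewrite opprD. Qed.

HB.instance Definition _ (R : zmodType) :=
  GRing.isZmodMorphism.Build (quaternion R) (quaternion R) (@quat_conj R)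
    (@quat_conj_is_zmod_morphism R).

Lemma quat_conjM (R : comNzRingType) (p q : quaternion R) :
  quat_conj (p * q) = quat_conj q * quat_conj p.
Proof. by case: p q => ? ? ? ? [? ? ? ?]; congr Quat => /=; ring. Qed.

Lemma quat_conjK (R : zmodType) : involutive (@quat_conj R).
Proof. by case=> ? ? ? ?; rewrite /quat_conj /= !opprK. Qed.

Lemma qre_mulC (R : comNzRingType) (p q : quaternion R) :
  qre (p * q) = qre (q * p).
Proof. by case: p q => ? ? ? ? [? ? ? ?] /=; ring. Qed.

Lemma qre_conj (R : zmodType) (q : quaternion R) : qre (quat_conj q) = qre q.
Proof. by []. Qed.

Lemma qre_realM (R : comNzRingType) (x : R) (q : quaternion R) :
  qre (quat_real x * q) = x * qre q.
Proof. by case: q => ? ? ? ? /=; ring. Qed.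

(** The radicand of [quat_norm]: without the root, its identities are polynomial and fall to
    [ring]. *)
Definition quat_sqnorm (R : comNzRingType) (q : quaternion R) : R :=
  qre q ^+ 2 + qi q ^+ 2 + qj q ^+ 2 + qk q ^+ 2.

Lemma quat_sqnormE (R : comNzRingType) (q : quaternion R) :
  qre (quat_conj q * q) = quat_sqnorm q.
Proof. by case: q => ? ? ? ?; rewrite /quat_sqnorm /=; ring. Qed.

Lemma quat_sqnormM (R : comNzRingType) (p q : quaternion R) :
  quat_sqnorm (p * q) = quat_sqnorm p * quat_sqnorm q.
Proof. by case: p q => ? ? ? ? [? ? ? ?]; rewrite /quat_sqnorm /=; ring. Qed.

Lemma quat_sqnorm_conj (R : comNzRingType) (q : quaternion R) :
  quat_sqnorm (quat_conj q) = quat_sqnorm q.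
Proof. by case: q => ? ? ? ?; rewrite /quat_sqnorm /=; ring. Qed.

Lemma quat_sqnorm_ge0 (R : realDomainType) (q : quaternion R) :
  0 <= quat_sqnorm q.
Proof. by rewrite !addr_ge0 ?sqr_ge0. Qed.

Lemma quat_unitary_sqnorm (R : realType) (q : quaternion R) :
  quat_unitary q -> quat_sqnorm q = 1.
Proof.
rewrite /quat_unitary /quat_norm -/(quat_sqnorm q) => h.
by rewrite -(sqr_sqrtr (quat_sqnorm_ge0 q)) h expr1n.
Qed.

(** * Adjoints, the real part of the trace, and the squared Frobenius norm *)

Lemma adjmxM (R : comNzRingType) (m n p : nat) (A : 'M[quaternion R]_(m, n))
    (B : 'M[quaternion R]_(n, p)) :
  adjmx (A *m B) = adjmx B *m adjmx A.
Proof.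
apply/matrixP => i j; rewrite !mxE raddf_sum /=.
by apply: eq_bigr => k _; rewrite !mxE quat_conjM.
Qed.

Lemma adjmxK (R : zmodType) (m n : nat) (A : 'M[quaternion R]_(m, n)) :
  adjmx (adjmx A) = A.
Proof. by apply/matrixP => i j; rewrite !mxE quat_conjK. Qed.

Lemma adjmxB (R : zmodType) (m n : nat) (A B : 'M[quaternion R]_(m, n)) :
  adjmx (A - B) = adjmx A - adjmx B.
Proof.
by apply/matrixP => i j; rewrite !mxE quat_conj_is_zmod_morphism.
Qed.

(** Over the quaternions the trace itself is not cyclic; its real part is, because [p * q] and
    [q * p] differ only in their imaginary parts. *)
Lemma qre_mxtrace_mulC (R : comNzRingType) (m n : nat)
    (A : 'M[quaternion R]_(m, n)) (B : 'M[quaternion R]_(n, m)) :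
  qre (\tr (A *m B)) = qre (\tr (B *m A)).
Proof.
rewrite /mxtrace !raddf_sum /=.
under eq_bigr do rewrite mxE raddf_sum.
rewrite exchange_big; apply: eq_bigr => i _; rewrite mxE raddf_sum /=.
by apply: eq_bigr => j _; rewrite qre_mulC.
Qed.

Definition sqfrobenius (R : comNzRingType) (m n : nat)
    (A : 'M[quaternion R]_(m, n)) : R := qre (\tr (adjmx A *m A)).

Lemma sqfrobeniusE (R : comNzRingType) (m n : nat)
    (A : 'M[quaternion R]_(m, n)) :
  sqfrobenius A = \sum_i \sum_j quat_sqnorm (A j i).
Proof.
rewrite /sqfrobenius /mxtrace raddf_sum; apply: eq_bigr => i _.
rewrite mxE raddf_sum; apply: eq_bigr => j _.
by rewrite -quat_sqnormE !mxE.
Qed.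

Lemma sqfrobenius_unitary_entries (R : realType) (m n : nat)
    (A : 'M[quaternion R]_(m, n)) :
  (forall i j, quat_unitary (A i j)) -> sqfrobenius A = m%:R * n%:R.
Proof.
move=> uA; rewrite sqfrobeniusE.
under eq_bigr => i _ do
  (under eq_bigr do rewrite (quat_unitary_sqnorm (uA _ _));
   rewrite sumr_const card_ord).
by rewrite sumr_const card_ord mulr_natr.
Qed.

Lemma sqfrobenius_ge0 (R : realDomainType) (m n : nat)
    (A : 'M[quaternion R]_(m, n)) : 0 <= sqfrobenius A.
Proof.
by rewrite sqfrobeniusE; do 2![apply: sumr_ge0 => ? _]; apply: quat_sqnorm_ge0.
Qed.

Lemma frobenius_ge0 (R : realType) (m n : nat) (A : 'M[quaternion R]_(m, n)) :
  0 <= frobenius A.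
Proof. exact: sqrtr_ge0. Qed.

Lemma sqr_frobenius (R : realType) (m n : nat) (A : 'M[quaternion R]_(m, n)) :
  frobenius A ^+ 2 = sqfrobenius A.
Proof. by rewrite sqr_sqrtr ?sqfrobenius_ge0. Qed.

Lemma sqfrobeniusB (R : comNzRingType) (m n : nat)
    (A B : 'M[quaternion R]_(m, n)) :
  sqfrobenius (A - B) =
    sqfrobenius A + sqfrobenius B - 2 * qre (\tr (adjmx A *m B)).
Proof.
(* The two cross terms are traces of mutually adjoint matrices, hence conjugate quaternions. *)
have sym : qre (\tr (adjmx B *m A)) = qre (\tr (adjmx A *m B)).
  rewrite -[RHS]qre_conj -[in RHS]mxtrace_tr; congr qre.
  rewrite /mxtrace raddf_sum; apply: eq_bigr => i _.
  by rewrite -{1}(adjmxK A) -adjmxM !mxE.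
rewrite /sqfrobenius adjmxB mulmxBl !mulmxBr !raddfB /= sym.
ring.
Qed.

(** * Consequences of an orthonormal eigenbasis [V] *)

Section Spectrum.
Variables (R : realType) (n : nat) (A : 'M[quaternion R]_n) (lam : n.-tuple R).
Variable V : 'M[quaternion R]_n.
Hypothesis VV1 : V *m adjmx V = 1%:M.
Hypothesis eigV :
  forall i, right_eigenvector A (quat_real (tnth lam i)) (col i V).

Let D : 'M[quaternion R]_n := diag_mx (\row_i quat_real (tnth lam i)).

(** The eigenvector equations are the columns of [A *m V = V *m D], with eigenvalues acting on the
    right; [VV1] then cancels [V]. *)
Lemma eigenbasis_decomposition : A = V *m D *m adjmx V.
Proof.
suff AV : A *m V = V *m D by rewrite -AV -mulmxA VV1 mulmx1.
apply/matrixP => i j; have [_ /matrixP/(_ i 0)] := eigV j.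
have -> : A *m col j V = col j (A *m V) by rewrite !colE mulmxA.
rewrite [col j _ i 0]mxE => ->; rewrite !mxE big_ord1 !mxE /= mulr1n.
rewrite (bigD1 j) //= !mxE eqxx mulr1n big1 ?addr0 // => k kj.
by rewrite !mxE (negbTE kj) mulr0n mulr0.
Qed.

Lemma qre_mxtrace_diagM (B : 'M[quaternion R]_n) :
  qre (\tr (D *m B)) = \sum_i tnth lam i * qre (B i i).
Proof.
rewrite /mxtrace raddf_sum; apply: eq_bigr => i _.
by rewrite mul_diag_mx !mxE /= qre_realM.
Qed.

(** Cycling [V] around the real trace leaves [D] times the Gram matrix of the rows of
    [U = adjmx V *m Q], whose diagonal holds the squared coordinates of [Q] in the eigenbasis. *)
Lemma qre_mxtrace_spectrum (m : nat) (Q : 'M[quaternion R]_(n, m)) :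
  qre (\tr (A *m (Q *m adjmx Q))) =
    \sum_i tnth lam i * \sum_j quat_sqnorm ((adjmx V *m Q) i j).
Proof.
rewrite eigenbasis_decomposition -!mulmxA qre_mxtrace_mulC -!mulmxA.
rewrite qre_mxtrace_diagM; apply: eq_bigr => i _; congr (_ * _).
set U := adjmx V *m Q.
have -> : adjmx V *m (Q *m (adjmx Q *m V)) = U *m adjmx U.
  by rewrite /U adjmxM adjmxK !mulmxA.
rewrite mxE raddf_sum; apply: eq_bigr => j _.
by rewrite -quat_sqnormE qre_mulC !mxE.
Qed.

Lemma sqfrobenius_eigenbasis (m : nat) (Q : 'M[quaternion R]_(n, m)) :
  sqfrobenius (adjmx V *m Q) = sqfrobenius Q.
Proof.
by rewrite /sqfrobenius adjmxM adjmxK mulmxA -(mulmxA _ V) VV1 mulmx1.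
Qed.

Lemma sqfrobenius_spectrum : adjmx V *m V = 1%:M -> quat_hermitian A ->
  sqfrobenius A = \sum_i tnth lam i ^+ 2.
Proof.
move=> V1V hermA; rewrite /sqfrobenius -hermA eigenbasis_decomposition.
rewrite -!mulmxA qre_mxtrace_mulC -!mulmxA V1V mulmx1.
rewrite (mulmxA (adjmx V)) V1V mul1mx qre_mxtrace_diagM.
by apply: eq_bigr => i _; rewrite !mxE eqxx mulr1n expr2.
Qed.

End Spectrum.

(** * Real inequalities for scaled eigenvalues [l], weights [p] and error [e], then the
    conclusion *)

Lemma mean_square_bounds (R : realFieldType) (n : nat)
    (l p : 'I_n -> R) (e : R) (i0 : 'I_n) :
  0 <= e -> (forall i, 0 <= p i) -> \sum_i p i = 1 ->
  \sum_i l i ^+ 2 = 1 -> (forall i, l i <= l i0) ->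
  e ^+ 2 = 2 - 2 * \sum_i l i * p i ->
  [/\ 1 - e <= l i0, l i0 <= 1 & forall i, i != i0 -> `|l i| <= e].
Proof.
move=> e0 p0 p1 l1 lmax eE.
have sqr_le1 i : l i ^+ 2 <= 1.
  by rewrite -l1 (bigD1 i) //= lerDl sumr_ge0 // => k _; rewrite sqr_ge0.
have geN1 i : -1 <= l i by have := sqr_le1 i; nra.
have meanC c : c = \sum_i c * p i by rewrite -mulr_sumr p1 mulr1.
have mean_ge : -1 <= \sum_i l i * p i.
  by rewrite (meanC (-1)); apply: ler_sum => i _; apply: ler_wpM2r.
have mean_le : \sum_i l i * p i <= l i0.
  by rewrite (meanC (l i0)); apply: ler_sum => i _; apply: ler_wpM2r.
split.
(* The mean is at least -1, so [e ^+ 2 <= 4]. *)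
- have e2 : e <= 2 by nra.
  nra.
- have := sqr_le1 i0; nra.
move=> i ii0; rewrite -(ler_pXn2r (n := 2)) ?nnegrE //.
rewrite real_normK ?num_real //.
have two : l i0 ^+ 2 + l i ^+ 2 <= 1.
  rewrite -l1 (bigD1 i0) //= (bigD1 i) //= addrA lerDl.
  by rewrite sumr_ge0 // => k _; rewrite sqr_ge0.
(* The threshold 2 makes [1 - e ^+ 2 / 2] nonnegative, so the lower bound on [l i0] may be squared:
   [l i0 ^+ 2 >= 1 - e ^+ 2 + e ^+ 4 / 4]. *)
have [e2|e2] := lerP (e ^+ 2) 2; first by nra.
by have := sqr_le1 i; lra.
Qed.

(* lam`_0, lam`_1, ... are the eigenvalues lambda_1 >= lambda_2 >= ... *)
Theorem mainTheorem4 (R : realType) (N : nat) (hN : (2 <= N)%N)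
  (Q : 'cV[quaternion R]_N) (hQ : forall i : 'I_N, quat_unitary (Q i 0))
  (O : 'M[quaternion R]_N) (hO : O = Q *m adjmx Q)
  (Ohat : 'M[quaternion R]_N) (hherm : quat_hermitian Ohat)
  (hunit : forall i j : 'I_N, quat_unitary (Ohat i j))
  (hdiag : forall i : 'I_N, Ohat i i = 1)
  (lam : N.-tuple R) (hlam : right_spectrum Ohat lam)
  (hsort : sorted >=%R lam) :
  [/\ 1 - relative_error Ohat O <= lam`_0 / N%:R,
      lam`_0 / N%:R <= 1,
      (forall i : nat, (1 <= i < N)%N ->
         `|lam`_i| / N%:R <= relative_error Ohat O) &
      (relative_error Ohat O < 1 / 2 -> lam`_0 - lam`_1 > 0)].
Proof.
have [V [V1V VV1 eigV]] := hlam.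
have N0 : (0 < N)%N by apply: leq_trans hN.
have NR0 : 0 < N%:R :> R by rewrite ltr0n.
have NRn0 : N%:R != 0 :> R by rewrite gt_eqF.
(* Each entry of [O] is a product of a unitary quaternion and a conjugate of one, hence unitary. *)
have sqO : sqfrobenius O = N%:R ^+ 2.
  rewrite (sqfrobenius_unitary_entries (A := O)) // => i j.
  rewrite /quat_unitary /quat_norm -/(quat_sqnorm _) hO !mxE big_ord1 !mxE.
  by rewrite quat_sqnormM quat_sqnorm_conj !quat_unitary_sqnorm ?mulr1 ?sqrtr1.
have sqOhat : sqfrobenius Ohat = N%:R ^+ 2.
  by rewrite sqfrobenius_unitary_entries.
have frobO : frobenius O = N%:R.
  by apply/eqP; rewrite -(eqrXn2 (n := 2)) ?frobenius_ge0 // sqr_frobenius sqO.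
pose l (i : 'I_N) := tnth lam i / N%:R.
(* Squared coordinates of [Q] in the eigenbasis; they add up to the squared norm of [Q], which is
   N. *)
pose p i := quat_sqnorm ((adjmx V *m Q) i 0) / N%:R.
pose i0 := Ordinal N0.
have lE (i : 'I_N) : l i = lam`_i / N%:R by rewrite /l (tnth_nth 0).
set e := relative_error _ _.
have eE : e = frobenius (Ohat - O) / N%:R by rewrite -frobO.
have e0 : 0 <= e by rewrite eE divr_ge0 ?frobenius_ge0.
have p0 i : 0 <= p i by rewrite divr_ge0 ?quat_sqnorm_ge0.
have p1 : \sum_i p i = 1.
  rewrite -mulr_suml; apply: (canLR (mulfK NRn0)); rewrite mul1r.
  have := sqfrobenius_eigenbasis VV1 Q; rewrite sqfrobeniusE big_ord1 => ->.
  by rewrite sqfrobenius_unitary_entries ?mulr1 // => k j; rewrite ord1.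
have l1 : \sum_i l i ^+ 2 = 1.
  under eq_bigr do rewrite expr_div_n.
  rewrite -mulr_suml -(sqfrobenius_spectrum VV1 eigV V1V hherm) sqOhat.
  by rewrite divff // expf_neq0.
have lmax i : l i <= l i0.
  rewrite !lE ler_pM2r ?invr_gt0 //=.
  have ge_trans : transitive (>=%R : rel R).
    by move=> y x z xy yz; apply: le_trans yz xy.
  have ge_refl : reflexive (>=%R : rel R) by move=> x; apply: lexx.
  by apply: (sorted_leq_nth ge_trans ge_refl) hsort _ _ _ _ _;
    rewrite ?inE ?size_tuple.
(* Both squared norms are N^2, and the cross term is N^2 times the mean, one factor N coming from
   [l] and one from [p]. *)
have e2 : e ^+ 2 = 2 - 2 * \sum_i l i * p i.
  rewrite eE expr_div_n sqr_frobenius sqfrobeniusB sqO sqOhat -hherm hO.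
  rewrite (qre_mxtrace_spectrum VV1 eigV).
  have -> : \sum_i tnth lam i * \sum_j quat_sqnorm ((adjmx V *m Q) i j) =
      N%:R ^+ 2 * \sum_i l i * p i.
    rewrite [RHS]mulr_sumr; apply: eq_bigr => i _.
    by rewrite big_ord1 /l /p; field.
  by field.
have [ge_l0 le_l0 le_l] := mean_square_bounds e0 p0 p1 l1 lmax e2.
have le_lam (i : nat) : (1 <= i < N)%N -> `|lam`_i| / N%:R <= e.
  (* Indices start at 0, so [1 <= i] says exactly that the ordinal differs from [i0]. *)
  case/andP=> i1 iN; have := le_l (Ordinal iN).
  by rewrite -val_eqE /= -lt0n i1 lE normrM normfV (gtr0_norm NR0) => ->.
split=> //; first by rewrite -(lE i0).
  by rewrite -(lE i0).
move=> e_small; have {}le_lam := le_lam 1%N hN.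
rewrite subr_gt0 -(ltr_pM2r (x := N%:R^-1)) ?invr_gt0 // -(lE i0).
(* The second scaled eigenvalue is at most [e], and [e < 1 - e <= l i0] as [e < 1 / 2]. *)
apply: le_lt_trans (_ : e < _); last by lra.
by apply: le_trans le_lam; rewrite ler_pM2r ?invr_gt0 // ler_norm.
Qed.
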